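(* Let $\mathfrak{r}=\mathfrak{r}_1\oplus\mathfrak{r}_2$ be a direct sum of two indecomposable solvable real Lie algebras $\mathfrak{r}_1,\mathfrak{r}_2$ of dimension three, and suppose that $\mathfrak{r}$ is not nilpotent. Then $\mathfrak{r}$ admits a symplectic form if and only if it is isomorphic to one of $$A_{3,1}\oplus A_{3,4}^{-1},\quad A_{3,1}\oplus A_{3,5}^{0},\quad A_{3,4}^{-1}\oplus A_{3,4}^{-1},\quad A_{3,4}^{-1}\oplus A_{3,5}^{0},\quad A_{3,5}^{0}\oplus A_{3,5}^{0}.$$ Here, on a dual basis $\{\omega_1,\omega_2,\omega_3\}$, these three-dimensional Lie algebras are given by the Maurer-Cartan equations: $A_{3,1}$: $d\omega_1=\omega_2\wedge\omega_3$, $d\omega_2=d\omega_3=0$; $A_{3,4}^{-1}$: $d\omega_1=\omega_1\wedge\omega_3$, $d\omega_2=-\omega_2\wedge\omega_3$, $d\omega_3=0$; $A_{3,5}^{0}$: $d\omega_1=\omega_2\wedge\omega_3$, $d\omega_2=-\omega_1\wedge\omega_3$, $d\omega_3=0$.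
   Context: All Lie algebras are finite-dimensional over $\mathbb{R}$. For a Lie algebra $\mathfrak{g}$, the exterior differential on $\mathfrak{g}^*$ is $d\omega(X,Y)=-\omega([X,Y])$ for $\omega\in\mathfrak{g}^*$, extended to $\bigwedge\mathfrak{g}^*$ as an antiderivation; the formulas for $d$ on a basis of $\mathfrak{g}^*$ (Maurer-Cartan equations) determine $\mathfrak{g}$. A symplectic form on $\mathfrak{g}$ with $\dim\mathfrak{g}=2n$ is $\omega\in\bigwedge^2\mathfrak{g}^*$ with $d\omega=0$ and $\bigwedge^n\omega\neq0$. A Lie algebra is indecomposable if it is not the direct sum of two nonzero ideals. Direct sums are direct sums of Lie algebras (both summands are ideals). *)

(* Defs.v *)
From HB Require Import structures.
From mathcomp Require Import all_boot all_order all_algebra.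
From mathcomp Require Import ring reals.

Set Implicit Arguments.
Unset Strict Implicit.
Unset Printing Implicit Defensive.

Import GRing.Theory.
Local Open Scope ring_scope.

(** * Finite-dimensional Lie algebras *)

HB.mixin Record isLieAlgebra (R : fieldType) g of Vector R g := {
  bracket : g -> g -> g;
  bracket_linearl : forall y, linear (bracket^~ y);
  bracket_linearr : forall x, linear (bracket x);
  bracketxx : forall x, bracket x x = 0;
  bracket_jacobi : forall x y z,
    bracket x (bracket y z) + bracket y (bracket z x)
      + bracket z (bracket x y) = 0
}.

#[short(type="lieAlgType")]
HB.structure Definition LieAlgebra (R : fieldType) :=
  { g of isLieAlgebra R g & Vector R g }.

Notation "[lie x , y ]" := (bracket x y)
  (at level 0, x, y at level 99, format "[lie  x ,  y ]") : ring_scope.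

Definition lie_isomorphic (R : fieldType) (g h : lieAlgType R) : Prop :=
  exists f : {linear g -> h},
    bijective f /\ forall x y, f [lie x, y] = [lie f x, f y].

Section DirectSum.
Variables (R : fieldType) (g h : lieAlgType R).
Implicit Types x y z : (g * h)%type.

Definition prod_bracket x y : g * h := ([lie x.1, y.1], [lie x.2, y.2]).

Fact prod_bracket_linearl y : linear (prod_bracket^~ y).
Proof.
by move=> a u v; rewrite /prod_bracket /= !bracket_linearl.
Qed.

Fact prod_bracket_linearr x : linear (prod_bracket x).
Proof.
by move=> a u v; rewrite /prod_bracket /= !bracket_linearr.
Qed.

Fact prod_bracketxx x : prod_bracket x x = 0.
Proof. by rewrite /prod_bracket !bracketxx. Qed.

Fact prod_bracket_jacobi x y z :
  prod_bracket x (prod_bracket y z) + prod_bracket y (prod_bracket z x)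
    + prod_bracket z (prod_bracket x y) = 0.
Proof. by congr pair; rewrite /= bracket_jacobi. Qed.

HB.instance Definition _ := isLieAlgebra.Build R (g * h)%type
  prod_bracket_linearl prod_bracket_linearr prod_bracketxx prod_bracket_jacobi.

End DirectSum.

Section Ideals.
Variables (R : fieldType) (g : lieAlgType R).
Implicit Types U V W I J : {vspace g}.

Definition lie_ideal I : Prop := forall x y, y \in I -> [lie x, y] \in I.

Definition lie_indecomposable : Prop :=
  ~ exists I J, [/\ lie_ideal I, lie_ideal J, I != 0%VS, J != 0%VS &
                    (I + J)%VS = fullv /\ directv (I + J)%VS].

(* The span of all brackets [u, v] with u in U and v in V; by bilinearity the
   brackets of basis vectors suffice (see [lie_commvP]). *)
Definition lie_commv U V : {vspace g} :=
  <<[seq [lie u, v] | u <- vbasis U, v <- vbasis V]>>%VS.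

Lemma lie_commvP U V W :
  reflect (forall u v, u \in U -> v \in V -> [lie u, v] \in W)
          (lie_commv U V <= W)%VS.
Proof.
have suml (I : finType) (F : I -> g) v :
    [lie \sum_i F i, v] = \sum_i [lie F i, v].
  elim/big_rec2: _ => [|i x y _ <-].
    by have := bracket_linearl v (-1) 0 0; rewrite scaler0 addr0 scaleN1r addNr.
  by have := bracket_linearl v 1 (F i) y; rewrite !scale1r.
have sumr (I : finType) (F : I -> g) u :
    [lie u, \sum_i F i] = \sum_i [lie u, F i].
  elim/big_rec2: _ => [|i x y _ <-].
    by have := bracket_linearr u (-1) 0 0; rewrite scaler0 addr0 scaleN1r addNr.
  by have := bracket_linearr u 1 (F i) y; rewrite !scale1r.
have scl a u v : [lie a *: u, v] = a *: [lie u, v].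
  have := bracket_linearl v a u 0; rewrite addr0 => ->.
  have := bracket_linearl v (-1) 0 0; rewrite scaler0 addr0 scaleN1r addNr => ->.
  by rewrite addr0.
have scr a u v : [lie u, a *: v] = a *: [lie u, v].
  have := bracket_linearr u a v 0; rewrite addr0 => ->.
  have := bracket_linearr u (-1) 0 0; rewrite scaler0 addr0 scaleN1r addNr => ->.
  by rewrite addr0.
apply: (iffP span_subvP) => [sW u v /coord_vbasis-> /coord_vbasis-> | sW w].
  rewrite suml; apply: memv_suml => i _; rewrite scl memvZ // sumr.
  apply: memv_suml => j _; rewrite scr memvZ //; apply: sW.
  by apply/allpairsP; exists ((vbasis U)`_i, (vbasis V)`_j);
     rewrite !mem_nth ?size_tuple.
case/allpairsP=> -[u v] [/= uU vV ->].
by apply: sW; apply: vbasis_mem.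
Qed.

Definition lie_solvable : Prop :=
  exists n, iter n (fun U => lie_commv U U) fullv = 0%VS.

Definition lie_nilpotent : Prop :=
  exists n, iter n (lie_commv fullv) fullv = 0%VS.

End Ideals.

(** * Exterior algebra of the dual and exterior differential *)

(* A form is a function of a list of vectors: its component of degree k is its
   restriction to the lists of size k. The elements of the k-th exterior power
   of the dual are singled out by [is_form k]; forms are compared pointwise. *)

Section Exterior.
Variables (R : fieldType) (V : vectType R).
Local Notation form := (seq V -> R).
Implicit Types (w a b : form) (s t : seq V) (f h : V -> R) (x y : V).

Definition is_form (k : nat) w : Prop :=
  [/\ forall s, size s != k -> w s = 0,
      forall s t, scalar (fun x => w (s ++ x :: t)) &
      forall s t u x, w (s ++ x :: t ++ x :: u) = 0].

Definition oneform f : form := fun s => if s is [:: x] then f x else 0.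

Definition contract x w : form := fun s => w (x :: s).

(* The degree involution, (-1)^k in degree k. *)
Definition grade w : form := fun s => (-1) ^+ size s * w s.

(* The wedge product normalised by (a /\ b)(x, y) = a(x) b(y) - a(y) b(x) in
   degree (1, 1). The recursion says that contraction is an antiderivation;
   unfolded, it is the signed sum over all shuffles of s. *)
Fixpoint wedge a b s : R :=
  if s is x :: s' then
    wedge (contract x a) b s' + wedge (grade a) (contract x b) s'
  else a [::] * b [::].

Definition wedge_exp w (n : nat) : form :=
  iter n (wedge w) (fun s => (nilp s)%:R).

Lemma wedge_oneform f h x y :
  wedge (oneform f) (oneform h) [:: x; y] = f x * h y - f y * h x.
Proof. by rewrite /= /grade /contract /=; ring. Qed.

Lemma wedge_eq0 a b s :
  (forall t u, (size t + size u)%N = size s -> a t = 0 \/ b u = 0) ->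
  wedge a b s = 0.
Proof.
elim: s a b => [|x s IHs] a b ab0 /=.
  by case: (ab0 [::] [::]) => // ->; rewrite ?mul0r ?mulr0.
rewrite !IHs ?addr0 // => t u tu.
  by rewrite /grade; case: (ab0 t (x :: u)) => [|->|]; rewrite ?mulr0 /= ?addnS ?tu; auto.
by apply: ab0; rewrite /= addSn tu.
Qed.

Lemma wedge_oneformE f h :
  wedge (oneform f) (oneform h) =1
    (fun s => if s is [:: x; y] then f x * h y - f y * h x else 0).
Proof.
have e0 s : size s != 2%N -> wedge (oneform f) (oneform h) s = 0.
  move=> s2; apply: wedge_eq0 => -[|? [|? t]] u /= tu; auto.
  by right; case: u tu => [|? []] //= tu; rewrite -tu in s2.
by case=> [|? [|? []]]; intros; rewrite ?wedge_oneform // e0.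
Qed.

Lemma eq_wedge a a' b b' : a =1 a' -> b =1 b' -> wedge a b =1 wedge a' b'.
Proof.
move=> eqa eqb s; elim: s a a' b b' eqa eqb => [|x s IHs] a a' b b' eqa eqb /=.
  by rewrite eqa eqb.
by congr (_ + _); apply: IHs => t; rewrite /contract /grade ?eqa ?eqb.
Qed.

Lemma wedge_linearl c a a' b s :
  wedge (fun t => c * a t + a' t) b s = c * wedge a b s + wedge a' b s.
Proof.
elim: s a a' b => [|x s IHs] a a' b /=; first by ring.
rewrite (@eq_wedge (grade (fun t => c * a t + a' t))
  (fun t => c * grade a t + grade a' t) _ (contract x b)) //; last first.
  by move=> t; rewrite /grade; ring.
by rewrite !IHs; ring.
Qed.

Lemma wedge_linearr c a b b' s :
  wedge a (fun t => c * b t + b' t) s = c * wedge a b s + wedge a b' s.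
Proof.
elim: s a b b' => [|x s IHs] a b b' /=; first by ring.
by rewrite !IHs; ring.
Qed.

Lemma wedgeNl a b s : wedge (fun t => - a t) b s = - wedge a b s.
Proof.
rewrite (@eq_wedge _ (fun t => (-2) * a t + a t) _ b) => [|t|//]; last by ring.
by rewrite wedge_linearl; ring.
Qed.

Lemma wedgeNr a b s : wedge a (fun t => - b t) s = - wedge a b s.
Proof.
rewrite (@eq_wedge _ a _ (fun t => (-2) * b t + b t)) => [|//|t]; last by ring.
by rewrite wedge_linearr; ring.
Qed.

Lemma gradeK w : grade (grade w) =1 w.
Proof. by move=> s; rewrite /grade mulrA -exprMn mulrNN mulr1 expr1n mul1r. Qed.

Lemma contract_grade x w : contract x (grade w) =1 (fun t => - grade (contract x w) t).
Proof. by move=> t; rewrite /contract /grade /= exprS; ring. Qed.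

End Exterior.

Section Differential.
Variables (R : fieldType) (g : lieAlgType R).
Local Notation form := (seq g -> R).
Implicit Types (w a b : form) (s t : seq g) (f : g -> R) (x y : g).

(* (L_x w)(y_1, .., y_k) = - \sum_i w(y_1, .., [x, y_i], .., y_k) *)
Fixpoint lie_der x w s : R :=
  if s is y :: s' then - w ([lie x, y] :: s') + lie_der x (contract y w) s'
  else 0.

(* Defined through Cartan's formula: contracting d w with x gives
   L_x w - d (contract x w). Lemmas [ext_diff_oneform], [ext_diff_linear] and
   [ext_diff_wedge] identify it as the antiderivation that extends
   d f (x, y) = - f([x, y]). *)
Fixpoint ext_diff w s : R :=
  if s is x :: s' then lie_der x w s' - ext_diff (contract x w) s' else 0.

Definition is_symplectic w : Prop :=
  exists2 n, \dim {:g} = (2 * n)%N &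
    [/\ is_form 2 w, ext_diff w =1 (fun=> 0) &
        ~ wedge_exp w n =1 (fun=> 0)].

Lemma eq_lie_der x w w' : w =1 w' -> lie_der x w =1 lie_der x w'.
Proof.
move=> eqw s; elim: s w w' eqw => //= y s IHs w w' eqw; rewrite eqw.
by congr (_ + _); apply: IHs => t; apply: eqw.
Qed.

Lemma eq_ext_diff w w' : w =1 w' -> ext_diff w =1 ext_diff w'.
Proof.
move=> eqw s; elim: s w w' eqw => //= x s IHs w w' eqw.
by rewrite (eq_lie_der x eqw); congr (_ - _); apply: IHs => t; apply: eqw.
Qed.

Lemma lie_der_linear x c w w' s :
  lie_der x (fun t => c * w t + w' t) s = c * lie_der x w s + lie_der x w' s.
Proof.
elim: s w w' => [|y s IHs] w w' /=; first by ring.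
by rewrite IHs; ring.
Qed.

Lemma ext_diff_linear c w w' s :
  ext_diff (fun t => c * w t + w' t) s = c * ext_diff w s + ext_diff w' s.
Proof.
elim: s w w' => [|x s IHs] w w' /=; first by ring.
by rewrite lie_der_linear IHs; ring.
Qed.

Lemma lie_derN x w s : lie_der x (fun t => - w t) s = - lie_der x w s.
Proof. by elim: s w => [|y s IHs] w /=; rewrite ?IHs ?oppr0 ?opprD. Qed.

Lemma ext_diffN w s : ext_diff (fun t => - w t) s = - ext_diff w s.
Proof. by elim: s w => [|x s IHs] w /=; rewrite ?IHs ?lie_derN ?oppr0 ?opprD. Qed.

Lemma lie_der_grade x w : lie_der x (grade w) =1 grade (lie_der x w).
Proof.
move=> s; elim: s w => [|y s IHs] w; first by rewrite /grade /= mulr0.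
rewrite /= (eq_lie_der x (contract_grade y w)) lie_derN IHs /grade /= exprS.
by ring.
Qed.

Lemma ext_diff_grade w : ext_diff (grade w) =1 (fun s => - grade (ext_diff w) s).
Proof.
move=> s; elim: s w => [|x s IHs] w; first by rewrite /grade /= mulr0 oppr0.
rewrite /= lie_der_grade (eq_ext_diff (contract_grade x w)) ext_diffN IHs.
by rewrite /grade /= exprS; ring.
Qed.

Lemma lie_der_wedge x a b s :
  lie_der x (wedge a b) s = wedge (lie_der x a) b s + wedge a (lie_der x b) s.
Proof.
elim: s a b => [|y s IHs] a b; first by rewrite /=; ring.
have ctr w : contract y (lie_der x w) =1
    (fun t => (-1) * contract [lie x, y] w t + lie_der x (contract y w) t).
  by move=> t; rewrite mulN1r.
have gr : grade (lie_der x a) =1 lie_der x (grade a).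
  by move=> t; rewrite lie_der_grade.
rewrite /= (eq_wedge (ctr a) (frefl b)) (eq_wedge (frefl (grade a)) (ctr b)).
rewrite (eq_wedge gr (frefl (contract y b))) wedge_linearl wedge_linearr.
rewrite (@eq_lie_der x _ (fun t => 1 * wedge (contract y a) b t
  + wedge (grade a) (contract y b) t)) => [|t]; last by rewrite mul1r.
by rewrite lie_der_linear !IHs; ring.
Qed.

Lemma ext_diff_wedge a b s :
  ext_diff (wedge a b) s = wedge (ext_diff a) b s + wedge (grade a) (ext_diff b) s.
Proof.
elim: s a b => [|x s IHs] a b; first by rewrite /=; ring.
have ctr w : contract x (ext_diff w) =1
    (fun t => (-1) * ext_diff (contract x w) t + lie_der x w t).
  by move=> t; rewrite mulN1r addrC.
have gr : grade (ext_diff a) =1 (fun t => - ext_diff (grade a) t).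
  by move=> t; rewrite ext_diff_grade opprK.
rewrite /= (eq_wedge (ctr a) (frefl b)) (eq_wedge (gradeK a) (ctr b)).
rewrite (eq_wedge gr (frefl (contract x b))).
rewrite (eq_wedge (contract_grade x a) (frefl (ext_diff b))).
rewrite wedge_linearl wedge_linearr !wedgeNl lie_der_wedge.
rewrite (@eq_ext_diff _ (fun t => 1 * wedge (contract x a) b t
  + wedge (grade a) (contract x b) t)) => [|t]; last by rewrite mul1r.
by rewrite ext_diff_linear !IHs (eq_wedge (gradeK a) (frefl _)); ring.
Qed.

Lemma lie_der_eq0 x w s :
  (forall t, size t = size s -> w t = 0) -> lie_der x w s = 0.
Proof.
elim: s w => //= y s IHs w w0; rewrite w0 // oppr0 add0r.
by apply: IHs => t tE; rewrite /contract w0 //= tE.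
Qed.

Lemma ext_diff_eq0 w s :
  (forall t, (size t).+1 = size s -> w t = 0) -> ext_diff w s = 0.
Proof.
elim: s w => //= x s IHs w w0.
rewrite lie_der_eq0 => [|t tE]; last by rewrite w0 ?tE.
by rewrite IHs ?subr0 // => t tE; rewrite /contract w0 //= tE.
Qed.

Lemma ext_diff_oneform f :
  ext_diff (oneform f) =1
    (fun s => if s is [:: x; y] then - f [lie x, y] else 0).
Proof.
case=> [|x [|y [|z s]]] //=; first by rewrite subr0.
  by rewrite !subr0 addr0.
by rewrite -[LHS]/(ext_diff (oneform f) [:: x, y, z & s]) ext_diff_eq0 // => -[|? []].
Qed.

End Differential.

Definition has_symplectic_form (R : fieldType) (g : lieAlgType R) : Prop :=
  exists w : seq g -> R, is_symplectic w.

(** * The Lie algebras A_{3,1}, A_{3,4}^{-1} and A_{3,5}^0 *)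

Local Arguments wedge : simpl never.

Section MaurerCartan.
Variable R : fieldType.
Local Notation form := (seq 'rV[R]_3 -> R).
Implicit Types x y z : 'rV[R]_3.

(* The dual of the standard basis of R^3; indices start at 0. *)
Definition dual3 (i : 'I_3) : form := oneform (fun x => x 0 i).

Local Notation omega1 := (dual3 0).
Local Notation omega2 := (dual3 1).
Local Notation omega3 := (dual3 2).

(* The bracket determined by the equations d omega_i = theta_i, that is, by
   - omega_i([x, y]) = theta_i(x, y). *)
Definition mc_bracket (theta : 'I_3 -> form) x y : 'rV[R]_3 :=
  \row_i - theta i [:: x; y].

Definition forms3 (t1 t2 t3 : form) (i : 'I_3) : form :=
  nth t1 [:: t1; t2; t3] i.

Definition A31_mc : 'I_3 -> form :=
  forms3 (wedge omega2 omega3) (fun=> 0) (fun=> 0).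

Definition A34_mc : 'I_3 -> form :=
  forms3 (wedge omega1 omega3) (fun s => - wedge omega2 omega3 s) (fun=> 0).

Definition A35_mc : 'I_3 -> form :=
  forms3 (wedge omega2 omega3) (fun s => - wedge omega1 omega3 s) (fun=> 0).

Record mc_axioms (theta : 'I_3 -> form) (b := mc_bracket theta) : Prop := {
  mc_linearl : forall y, linear (b^~ y);
  mc_linearr : forall x, linear (b x);
  mc_bracketxx : forall x, b x x = 0;
  mc_jacobi : forall x y z, b x (b y z) + b y (b z x) + b z (b x y) = 0
}.

Lemma wedge_dual3 i j x y :
  wedge (dual3 i) (dual3 j) [:: x; y] = x 0 i * y 0 j - y 0 i * x 0 j.
Proof. by rewrite wedge_oneform; ring. Qed.

Fact A31_mc_axioms : mc_axioms A31_mc.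
Proof.
split=> [y a u v|x a u v|x|x y z]; apply/rowP=> -[[|[|[|//]]] ?];
by rewrite !mxE /A31_mc /forms3 /= ?wedge_dual3 ?mxE /= ?wedge_dual3; ring.
Qed.

Fact A34_mc_axioms : mc_axioms A34_mc.
Proof.
split=> [y a u v|x a u v|x|x y z]; apply/rowP=> -[[|[|[|//]]] ?];
by rewrite !mxE /A34_mc /forms3 /= ?wedge_dual3 ?mxE /= ?wedge_dual3; ring.
Qed.

Fact A35_mc_axioms : mc_axioms A35_mc.
Proof.
split=> [y a u v|x a u v|x|x y z]; apply/rowP=> -[[|[|[|//]]] ?];
by rewrite !mxE /A35_mc /forms3 /= ?wedge_dual3 ?mxE /= ?wedge_dual3; ring.
Qed.

End MaurerCartan.

Definition A31 (R : fieldType) : Type := 'rV[R]_3.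
HB.instance Definition _ (R : fieldType) := Vector.on (A31 R).
HB.instance Definition _ (R : fieldType) := isLieAlgebra.Build R (A31 R)
  (mc_linearl (A31_mc_axioms R)) (mc_linearr (A31_mc_axioms R))
  (mc_bracketxx (A31_mc_axioms R)) (mc_jacobi (A31_mc_axioms R)).

Definition A34m1 (R : fieldType) : Type := 'rV[R]_3.
HB.instance Definition _ (R : fieldType) := Vector.on (A34m1 R).
HB.instance Definition _ (R : fieldType) := isLieAlgebra.Build R (A34m1 R)
  (mc_linearl (A34_mc_axioms R)) (mc_linearr (A34_mc_axioms R))
  (mc_bracketxx (A34_mc_axioms R)) (mc_jacobi (A34_mc_axioms R)).

Definition A35_0 (R : fieldType) : Type := 'rV[R]_3.
HB.instance Definition _ (R : fieldType) := Vector.on (A35_0 R).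
HB.instance Definition _ (R : fieldType) := isLieAlgebra.Build R (A35_0 R)
  (mc_linearl (A35_mc_axioms R)) (mc_linearr (A35_mc_axioms R))
  (mc_bracketxx (A35_mc_axioms R)) (mc_jacobi (A35_mc_axioms R)).

Lemma A31_maurer_cartan (R : fieldType)
    (omega := @dual3 R : 'I_3 -> seq (A31 R) -> R) :
  [/\ ext_diff (omega 0) =1 wedge (omega 1) (omega 2),
      ext_diff (omega 1) =1 (fun=> 0) &
      ext_diff (omega 2) =1 (fun=> 0)].
Proof.
split=> s; rewrite /omega ext_diff_oneform ?wedge_oneformE;
  move: s => [|x [|y []]]; intros; rewrite ?oppr0 //.
all: by rewrite mxE /A31_mc /forms3 /= ?wedge_dual3 ?oppr0 ?opprK //; ring.
Qed.

Lemma A34m1_maurer_cartan (R : fieldType)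
    (omega := @dual3 R : 'I_3 -> seq (A34m1 R) -> R) :
  [/\ ext_diff (omega 0) =1 wedge (omega 0) (omega 2),
      ext_diff (omega 1) =1 (fun s => - wedge (omega 1) (omega 2) s) &
      ext_diff (omega 2) =1 (fun=> 0)].
Proof.
split=> s; rewrite /omega ext_diff_oneform ?wedge_oneformE;
  move: s => [|x [|y []]]; intros; rewrite ?oppr0 //.
all: by rewrite mxE /A34_mc /forms3 /= ?wedge_dual3 ?oppr0 ?opprK //; ring.
Qed.

Lemma A35_0_maurer_cartan (R : fieldType)
    (omega := @dual3 R : 'I_3 -> seq (A35_0 R) -> R) :
  [/\ ext_diff (omega 0) =1 wedge (omega 1) (omega 2),
      ext_diff (omega 1) =1 (fun s => - wedge (omega 0) (omega 2) s) &
      ext_diff (omega 2) =1 (fun=> 0)].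
Proof.
split=> s; rewrite /omega ext_diff_oneform ?wedge_oneformE;
  move: s => [|x [|y []]]; intros; rewrite ?oppr0 //.
all: by rewrite mxE /A35_mc /forms3 /= ?wedge_dual3 ?oppr0 ?opprK //; ring.
Qed.

(* Main.v *)
From HB Require Import structures.
From mathcomp Require Import all_boot all_order all_algebra.
From mathcomp Require Import ring reals.
(* Defs comes last because its [is_symplectic] is shadowed by the one of
   mathcomp's theory of sesquilinear forms. *)
Require Import Defs.

Set Implicit Arguments.
Unset Strict Implicit.
Unset Printing Implicit Defensive.

Import Order.TTheory GRing.Theory Num.Theory.
Local Open Scope ring_scope.

(** Any 2-dimensional subspace containing [g, g] is an ideal; correcting it if
    it is not abelian, one writes a solvable g of dimension 3 as the semidirect
    product of an abelian ideal V = <e1, e2> and a line <e3> acting on V by a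
    2x2 matrix A. If A is singular with nonzero trace, or A = 0, then g
    decomposes. So an indecomposable g has tr A <> 0 and det A <> 0, or
    tr A = 0 and A <> 0.

    In the first case let w be a closed 2-form on the direct sum of g and h.
    Closedness gives w(A v, u) = 0 for v in V and u in h, hence w(V, h) = 0,
    and tr A * w(e1, e2) = 0. Then w(V, V) = 0, some nonzero v in V is also
    orthogonal to e3, and v lies in the radical of w. The top power of w is
    contracted to 0 by v, so it vanishes, and w is not symplectic.

    In the second case A has a cyclic vector and A^2 = mu is scalar; the sign of
    mu, after rescaling e3, gives A_{3,1}, A_{3,4}^{-1} or A_{3,5}^0. When both
    summands are traceless, w1 /\ w2 + w1' /\ w2' + w3 /\ w3' is symplectic. *)

(** * Alternating forms and nondegeneracy *)

Section Forms.
Variables (R : fieldType) (V : vectType R).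
Local Notation form := (seq V -> R).
Implicit Types (w a b : form) (s t u : seq V) (x y v : V).

(* Alternation is only required for adjacent arguments, which makes the
   predicate stable under contraction and easy to check on wedge products. *)
Definition multilinear w := forall s t, scalar (fun x => w (s ++ x :: t)).
Definition adj_alternating w := forall s t x, w (s ++ x :: x :: t) = 0.

Lemma multilinear_contract x w : multilinear w -> multilinear (contract x w).
Proof. by move=> wl s t; apply: (wl (x :: s) t). Qed.

Lemma adj_alternating_contract x w :
  adj_alternating w -> adj_alternating (contract x w).
Proof. by move=> wa s t; apply: (wa (x :: s) t). Qed.

Lemma multilinear_grade w : multilinear w -> multilinear (grade w).
Proof.
by move=> wl s t k x y; rewrite /grade !size_cat /= wl /=; ring.
Qed.

Lemma adj_alternating_grade w : adj_alternating w -> adj_alternating (grade w).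
Proof. by move=> wa s t x; rewrite /grade wa mulr0. Qed.

Lemma multilinear_wedge a b :
  multilinear a -> multilinear b -> multilinear (wedge a b).
Proof.
move=> al bl s; elim: s a b al bl => [|z s IHs] a b al bl t k x y /=.
  rewrite (@eq_wedge _ _ (contract (k *: x + y) a)
    (fun s => k * contract x a s + contract y a s) b b) //; last first.
    by move=> s; rewrite /contract (al [::] s).
  rewrite (@eq_wedge _ _ (grade a) (grade a) (contract (k *: x + y) b)
    (fun s => k * contract x b s + contract y b s)) //; last first.
    by move=> s; rewrite /contract (bl [::] s).
  by rewrite wedge_linearl wedge_linearr; ring.
have al' := multilinear_contract z al; have bl' := multilinear_contract z bl.
have gl := multilinear_grade al.
by rewrite (IHs _ _ al' bl) (IHs _ _ gl bl') /=; ring.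
Qed.

(** At a repeated argument [x] the recursion yields four terms. The two with a double contraction
    vanish, and the two mixed ones cancel because contraction and [grade] anticommute. *)
Lemma adj_alternating_wedge a b :
  adj_alternating a -> adj_alternating b -> adj_alternating (wedge a b).
Proof.
move=> aa ba s; elim: s a b aa ba => [|z s IHs] a b aa ba t x /=.
  rewrite (eq_wedge (contract_grade x a) (frefl _)) wedgeNl.
  rewrite (@wedge_eq0 _ _ (contract x (contract x a))); last first.
    by move=> s u _; left; apply: (aa [::] s).
  rewrite [X in _ + (_ + X)]wedge_eq0; last first.
    by move=> s u _; right; apply: (ba [::] u).
  by ring.
have aa' := adj_alternating_contract z aa.
have ba' := adj_alternating_contract z ba.
by rewrite (IHs _ _ aa' ba) (IHs _ _ (adj_alternating_grade aa) ba') addr0.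
Qed.

Lemma multilinearD w s t x y : multilinear w ->
  w (s ++ (x + y) :: t) = w (s ++ x :: t) + w (s ++ y :: t).
Proof. by move=> wl; have := wl s t 1 x y; rewrite /= scale1r mul1r. Qed.

Lemma multilinear0 w s t : multilinear w -> w (s ++ 0 :: t) = 0.
Proof.
move=> wl; have := wl s t (-1) 0 0.
by rewrite /= scaler0 addr0 mulN1r addNr.
Qed.

Lemma multilinearZ w s t k x : multilinear w ->
  w (s ++ (k *: x) :: t) = k * w (s ++ x :: t).
Proof.
by move=> wl; have := wl s t k x 0; rewrite /= addr0 multilinear0 ?addr0.
Qed.

Lemma adj_swap w s t x y : multilinear w -> adj_alternating w ->
  w (s ++ x :: y :: t) = - w (s ++ y :: x :: t).
Proof.
move=> wl wa; apply/eqP; rewrite -addr_eq0; apply/eqP.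
have := wa s t (x + y); rewrite multilinearD //.
have E z : w (s ++ z :: x + y :: t) = w (s ++ z :: x :: t) + w (s ++ z :: y :: t).
  by have := multilinearD (rcons s z) t x y wl; rewrite !cat_rcons.
by rewrite !E !wa addr0 add0r.
Qed.

Lemma contract_eq0_mem w v s t : multilinear w -> adj_alternating w ->
  contract v w =1 (fun=> 0) -> w (s ++ v :: t) = 0.
Proof.
move=> wl wa wv; elim/last_ind: s t => [|s x IHs] t; first exact: wv.
by rewrite cat_rcons adj_swap // IHs oppr0.
Qed.

Lemma alternating_mem w x s : multilinear w -> adj_alternating w ->
  x \in s -> w (x :: s) = 0.
Proof.
move=> wl wa /splitPr[p q].
rewrite -[LHS]/(contract x w (p ++ x :: q)); apply: contract_eq0_mem.
- exact: multilinear_contract.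
- exact: adj_alternating_contract.
- by move=> s'; rewrite /contract (wa [::] s' x).
Qed.

Lemma alternating_uniq w s : multilinear w -> adj_alternating w ->
  ~~ uniq s -> w s = 0.
Proof.
elim: s w => //= x s IHs w wl wa.
rewrite negb_and negbK => /orP[xs|]; first exact: alternating_mem.
move=> sU; apply: (IHs (contract x w)) => //.
  exact: multilinear_contract.
exact: adj_alternating_contract.
Qed.

Lemma multilinear_span w (B : seq V) n : multilinear w -> (<<B>> = fullv)%VS ->
  (forall s, size s = n -> {subset s <= B} -> w s = 0) ->
  forall s, size s = n -> w s = 0.
Proof.
move=> wl spanB w0.
(* Arguments are expanded one at a time: those in [s] already come from [B], those in [t] are still
   arbitrary. *)
suff H : forall t s, size (s ++ t) = n -> {subset s <= B} -> w (s ++ t) = 0.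
  by move=> s sn; apply: (H s [::]).
elim=> [|x t IHt] s; first by rewrite cats0; apply: w0.
move=> st sB; have: x \in <<in_tuple B>>%VS by rewrite /= spanB memvf.
move/coord_span=> ->; set c := fun i => _; rewrite /=.
elim/big_rec: _ => [|i y _ IHy]; first exact: multilinear0.
rewrite multilinearD // IHy addr0 multilinearZ // -cat_rcons IHt ?mulr0 //.
  by rewrite -st !size_cat size_rcons /= addnS.
move=> z; rewrite mem_rcons inE => /orP[/eqP->|/sB//].
by apply: mem_nth; apply: ltn_ord.
Qed.

(** It suffices to evaluate on vectors of a basis made of [v] and a basis [B] of a complement.
    Either [v] occurs and can be moved to the front, or all [\dim {:V}] arguments lie in [B], which
    has one element fewer, so one of them is repeated. *)
Lemma contract_eq0_top w v : multilinear w -> adj_alternating w ->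
  v != 0 -> contract v w =1 (fun=> 0) ->
  forall s, size s = \dim {:V} -> w s = 0.
Proof.
move=> wl wa v0 wv.
set B := vbasis (<[v]>^C)%VS.
have spanB : (<<v :: B>> = fullv)%VS.
  by rewrite span_cons /B (span_basis (vbasisP _)) addv_complf.
apply: (multilinear_span wl spanB) => s sdim sB.
case: (boolP (v \in s)) => [/splitPr[p q]|vs]; first exact: contract_eq0_mem.
apply: alternating_uniq => //; apply/negP => sU.
have: (size s <= size B)%N.
  apply: uniq_leq_size => // x xs; have := sB x xs; rewrite inE => /orP[/eqP xv|//].
  by rewrite -xv xs in vs.
rewrite sdim size_tuple dimv_compl dim_vline v0 leqNgt subn1 ltn_predL.
by rewrite (leq_trans _ (dimvS (subvf <[v]>%VS))) // dim_vline v0.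
Qed.

Lemma is_form_adj k w : is_form k w -> multilinear w /\ adj_alternating w.
Proof. by case=> _ wl wa; split=> // s t x; apply: (wa s [::] t x). Qed.

Lemma wedge_exp_multilinear w n :
  multilinear w -> adj_alternating w -> multilinear (wedge_exp w n) /\
  adj_alternating (wedge_exp w n).
Proof.
move=> wl wa; elim: n => [|n [IHl IHa]]; last first.
  by split; [apply: multilinear_wedge | apply: adj_alternating_wedge].
have nil0 s x t : nilp (s ++ x :: t) = false by case: s.
by split=> [s t k x y|s t x]; rewrite /wedge_exp /= !nil0 //=; ring.
Qed.

Lemma wedge_exp_degree w n s :
  is_form 2 w -> size s != (2 * n)%N -> wedge_exp w n s = 0.
Proof.
case=> w2 _ _; elim: n s => [|n IHn] s.
  by rewrite muln0 /wedge_exp /=; case: s.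
move=> sn; apply: wedge_eq0 => t u tu.
case: (eqVneq (size t) 2%N) => [t2|/w2->]; last by left.
right; apply: IHn; apply: contraNneq sn => un.
by rewrite -tu t2 un mulnS.
Qed.

Lemma contract_wedge_exp w v n : multilinear w -> contract v w =1 (fun=> 0) ->
  contract v (wedge_exp w n) =1 (fun=> 0).
Proof.
move=> wl wv; elim: n => [|n IHn] s; first by rewrite /contract /wedge_exp.
rewrite /contract -[LHS]/(wedge (contract v w) (wedge_exp w n) s +
  wedge (grade w) (contract v (wedge_exp w n)) s).
by rewrite !wedge_eq0 ?addr0 // => t u _; [right; apply: IHn | left; apply: wv].
Qed.

(** A vector in the radical of [w] also contracts every power of [w] to 0, and the power in question
    has top degree [2 * n]. On lists of any other length it vanishes by degree. *)
Lemma wedge_exp_eq0 w v n : is_form 2 w -> \dim {:V} = (2 * n)%N ->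
  v != 0 -> (forall y, w [:: v; y] = 0) -> wedge_exp w n =1 (fun=> 0).
Proof.
move=> wf dimV v0 wv s; have [wl wa] := is_form_adj wf.
have [Wl Wa] := wedge_exp_multilinear n wl wa.
have [sn|sn] := eqVneq (size s) (2 * n)%N; last exact: wedge_exp_degree.
apply: (contract_eq0_top Wl Wa v0); last by rewrite sn dimV.
apply: contract_wedge_exp => // t; case: wf => w2 _ _.
by case: t => [|y [|z t]]; rewrite /contract ?wv ?w2.
Qed.

End Forms.

(** * Nondegeneracy and closedness of a symplectic form *)

Section Symplectic.
Variables (R : fieldType) (g : lieAlgType R).
Implicit Types (w : seq g -> R) (x y z : g).

Lemma symplectic_nondegenerate w x :
  is_symplectic w -> (forall y, w [:: x; y] = 0) -> x = 0.
Proof.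
case=> n dimg [wf _ wn] wx; apply/eqP; apply: contra_notT wn => x0.
exact: wedge_exp_eq0 dimg x0 wx.
Qed.

Lemma ext_diff_2form w x y z :
  ext_diff w [:: x; y; z] =
    - w [:: [lie x, y]; z] - w [:: y; [lie x, z]] + w [:: x; [lie y, z]].
Proof.
by rewrite /= /contract; ring.
Qed.

Lemma symplectic_closed w x y z : is_symplectic w ->
  w [:: [lie x, y]; z] + w [:: y; [lie x, z]] = w [:: x; [lie y, z]].
Proof.
case=> n _ [wf dw _]; apply/eqP; rewrite -subr_eq0 -oppr_eq0.
by rewrite opprB addrC opprD -ext_diff_2form dw.
Qed.

End Symplectic.

(** * Pullback of forms along a morphism of Lie algebras *)

Section Pullback.
Variables (R : fieldType) (g h : lieAlgType R) (f : {linear g -> h}).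
Implicit Types (w a b : seq h -> R).

Definition pullback w : seq g -> R := fun s => w (map f s).

Lemma pullback_wedge a b :
  wedge (pullback a) (pullback b) =1 pullback (wedge a b).
Proof.
move=> s; elim: s a b => //= x s IHs a b.
rewrite -[RHS]/(pullback (wedge (contract (f x) a) b) s +
  pullback (wedge (grade a) (contract (f x) b)) s) -!IHs.
congr (_ + _); apply: eq_wedge => t //.
by rewrite /grade /pullback size_map.
Qed.

Lemma pullback_wedge_exp w n :
  wedge_exp (pullback w) n =1 pullback (wedge_exp w n).
Proof.
elim: n => [|n IHn] s; first by case: s.
by rewrite /pullback /= -[RHS]/(pullback _ s) -pullback_wedge; apply: eq_wedge.
Qed.

Lemma is_form_pullback k w : is_form k w -> is_form k (pullback w).
Proof.
case=> wk wl wa; split=> [s sk|s t a x y|s t u x].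
- by rewrite /pullback wk ?size_map.
- by rewrite /pullback !map_cat /= linearP wl.
- by rewrite /pullback map_cat /= map_cat /= wa.
Qed.

Hypothesis f_bracket : forall x y, f [lie x, y] = [lie f x, f y].

Lemma pullback_lie_der x w : lie_der x (pullback w) =1 pullback (lie_der (f x) w).
Proof.
move=> s; elim: s w => //= y s IHs w.
by rewrite -[RHS]/(- w ([lie f x, f y] :: map f s) +
  pullback (lie_der (f x) (contract (f y) w)) s) -IHs -f_bracket.
Qed.

Lemma pullback_ext_diff w : ext_diff (pullback w) =1 pullback (ext_diff w).
Proof.
move=> s; elim: s w => //= x s IHs w.
by rewrite pullback_lie_der -[RHS]/(pullback (lie_der (f x) w) s -
  pullback (ext_diff (contract (f x) w)) s) -IHs.
Qed.

Lemma bijective_dim : bijective f -> \dim {:g} = \dim {:h}.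
Proof.
case=> f' fK f'K; rewrite -(@limg_dim_eq _ _ _ (linfun f) fullv); last first.
  apply/eqP; rewrite capfv -subv0; apply/subvP=> x.
  by rewrite memv_ker lfunE /= memv0 -{2}(fK x) => /eqP->; rewrite -(linear0 f) fK.
congr (\dim _); apply/eqP; rewrite eqEsubv subvf /=; apply/subvP=> y _.
by rewrite -(f'K y) -(lfunE f); apply: memv_img; apply: memvf.
Qed.

Lemma symplectic_pullback w : bijective f ->
  is_symplectic w -> is_symplectic (pullback w).
Proof.
move=> fB; case: (fB) => f' fK f'K [n dimh [wf dw wn]]; exists n; first by rewrite -dimh bijective_dim.
split=> [|s|Wn].
- exact: is_form_pullback.
- by rewrite pullback_ext_diff /pullback dw.
(* Surjectivity enters here: every list in [h] is the image of a list in [g], so the top power on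
   [h] would vanish as well. *)
- apply: wn => s; have := Wn (map f' s).
  by rewrite pullback_wedge_exp /pullback mapK.
Qed.

End Pullback.

(** * Bases adapted to an abelian ideal *)

Section Bracket.
Variables (R : fieldType) (g : lieAlgType R).
Implicit Types (x y z : g) (k : R).

Lemma bracketDl x y z : [lie x + y, z] = [lie x, z] + [lie y, z].
Proof. by have := bracket_linearl z 1 x y; rewrite !scale1r. Qed.

Lemma bracketDr x y z : [lie x, y + z] = [lie x, y] + [lie x, z].
Proof. by have := bracket_linearr x 1 y z; rewrite !scale1r. Qed.

Lemma bracket0l x : [lie 0, x] = 0.
Proof. by have := bracket_linearl x (-1) 0 0; rewrite scaler0 addr0 scaleN1r addNr. Qed.

Lemma bracket0r x : [lie x, 0] = 0.
Proof. by have := bracket_linearr x (-1) 0 0; rewrite scaler0 addr0 scaleN1r addNr. Qed.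

Lemma bracketZl k x y : [lie k *: x, y] = k *: [lie x, y].
Proof. by have := bracket_linearl y k x 0; rewrite bracket0l !addr0. Qed.

Lemma bracketZr k x y : [lie x, k *: y] = k *: [lie x, y].
Proof. by have := bracket_linearr x k y 0; rewrite bracket0r !addr0. Qed.

Lemma bracketC x y : [lie x, y] = - [lie y, x].
Proof.
apply/eqP; rewrite -addr_eq0; have := bracketxx (x + y).
by rewrite bracketDl !bracketDr !bracketxx addr0 add0r => ->.
Qed.

End Bracket.

Section Comb3.
Variables (R : fieldType) (V : vectType R).
Implicit Types (e f x : V) (a b c k : R).

Definition comb3 e1 e2 e3 a b c := a *: e1 + b *: e2 + c *: e3.

Lemma comb3D e1 e2 e3 a b c a' b' c' :
  comb3 e1 e2 e3 a b c + comb3 e1 e2 e3 a' b' c' =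
  comb3 e1 e2 e3 (a + a') (b + b') (c + c').
Proof. by rewrite /comb3 !scalerDl addrACA; congr (_ + _); rewrite addrACA. Qed.

Lemma comb3Z e1 e2 e3 k a b c :
  k *: comb3 e1 e2 e3 a b c = comb3 e1 e2 e3 (k * a) (k * b) (k * c).
Proof. by rewrite /comb3 !scalerDr !scalerA. Qed.

Lemma comb3_1 e1 e2 e3 : e1 = comb3 e1 e2 e3 1 0 0.
Proof. by rewrite /comb3 scale1r !scale0r !addr0. Qed.

Lemma comb3_2 e1 e2 e3 : e2 = comb3 e1 e2 e3 0 1 0.
Proof. by rewrite /comb3 scale1r !scale0r addr0 add0r. Qed.

Lemma comb3_3 e1 e2 e3 : e3 = comb3 e1 e2 e3 0 0 1.
Proof. by rewrite /comb3 scale1r !scale0r !add0r. Qed.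

Lemma comb3_0 e1 e2 e3 : 0 = comb3 e1 e2 e3 0 0 0.
Proof. by rewrite /comb3 !scale0r !add0r. Qed.

Lemma comb3P e1 e2 e3 x :
  reflect (exists a b c, x = comb3 e1 e2 e3 a b c) (x \in <<[:: e1; e2; e3]>>%VS).
Proof.
rewrite !span_cons span_nil addv0.
apply: (iffP memv_addP) => [[u /vlineP[a ->] [v /memv_addP]]|].
  case=> _ /vlineP[b ->] [_ /vlineP[c ->] ->] ->.
  by exists a, b, c; rewrite /comb3 addrA.
case=> a [b] [c ->]; exists (a *: e1); first by rewrite memvZ ?memv_line.
exists (b *: e2 + c *: e3); last by rewrite addrA.
by apply: memv_add; rewrite memvZ ?memv_line.
Qed.

Lemma basis3_change e1 e2 e3 f1 f2 f3 :
  basis_of fullv [:: e1; e2; e3] ->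
  e1 \in <<[:: f1; f2; f3]>>%VS -> e2 \in <<[:: f1; f2; f3]>>%VS ->
  e3 \in <<[:: f1; f2; f3]>>%VS -> basis_of fullv [:: f1; f2; f3].
Proof.
move=> eB e1f e2f e3f; rewrite basisEdim /= -(size_basis eB) leqnn andbT.
rewrite -(span_basis eB); apply/span_subvP => x.
by rewrite !inE => /or3P[]/eqP->.
Qed.

Lemma coord3 e1 e2 e3 : basis_of fullv [:: e1; e2; e3] ->
  exists c1 c2 c3 : {scalar V},
    (forall x, x = comb3 e1 e2 e3 (c1 x) (c2 x) (c3 x)) /\
    (forall a b c, [/\ c1 (comb3 e1 e2 e3 a b c) = a,
       c2 (comb3 e1 e2 e3 a b c) = b & c3 (comb3 e1 e2 e3 a b c) = c]).
Proof.
move=> eB; pose X := [tuple e1; e2; e3].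
exists (coord X 0), (coord X 1), (coord X 2); split=> [x|a b c].
  rewrite {1}(coord_basis (X := X) eB (memvf x)) !big_ord_recl big_ord0 addr0 /=.
  by rewrite /comb3 addrA; congr (_ *: _ + _ *: _ + _ *: _); congr (coord _ _ _);
     apply: val_inj.
have -> : comb3 e1 e2 e3 a b c =
    \sum_(i < 3) (fun i : 'I_3 => [:: a; b; c]`_i) i *: X`_i.
  by rewrite !big_ord_recl big_ord0 addr0 /= addrA.
have eF : free X by exact: basis_free eB.
by split; exact: (coord_sum_free (fun i : 'I_3 => [:: a; b; c]`_i) _ eF).
Qed.

End Comb3.

Section SemidirectBasis.
Variables (R : fieldType) (g : lieAlgType R).
Implicit Types (a b c d k : R) (e f x y z : g).

(* g is the semidirect product of the abelian ideal <e1, e2> and of <e3>, which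
   acts by the matrix with rows (a, b) and (c, d). *)
Definition semidirect_basis a b c d e1 e2 e3 : Prop :=
  [/\ basis_of fullv [:: e1; e2; e3], [lie e1, e2] = 0,
      [lie e3, e1] = a *: e1 + c *: e2 & [lie e3, e2] = b *: e1 + d *: e2].

Lemma semidirect_bracket a b c d e1 e2 e3 (x1 x2 x3 y1 y2 y3 : R) :
  semidirect_basis a b c d e1 e2 e3 ->
  [lie comb3 e1 e2 e3 x1 x2 x3, comb3 e1 e2 e3 y1 y2 y3] =
  comb3 e1 e2 e3
    (x3 * (a * y1 + b * y2) - y3 * (a * x1 + b * x2))
    (x3 * (c * y1 + d * y2) - y3 * (c * x1 + d * x2)) 0.
Proof.
case=> _ e12 e31 e32; rewrite {1 2}/comb3 !bracketDl !bracketDr !bracketZl !bracketZr.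
rewrite !bracketxx (bracketC e2 e1) (bracketC e1 e3) (bracketC e2 e3).
rewrite e12 e31 e32.
have E p q : p *: e1 + q *: e2 = comb3 e1 e2 e3 p q 0.
  by rewrite /comb3 scale0r addr0.
rewrite !E !oppr0 !scaler0 (comb3_0 e1 e2 e3) -!scaleN1r.
by rewrite !(comb3Z, comb3D); congr comb3; ring.
Qed.

(** If [A] and [A'] are the old and new matrices and [P] has columns [(p, q)] and [(r, s)], the four
    equations say [k A P = P A']: conjugation inside the ideal combined with a rescaling of [e3]. *)
Lemma semidirect_change a b c d e1 e2 e3 p q r s k a' b' c' d' :
  semidirect_basis a b c d e1 e2 e3 -> p * s - q * r != 0 -> k != 0 ->
  k * (a * p + b * q) = a' * p + c' * r -> k * (c * p + d * q) = a' * q + c' * s ->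
  k * (a * r + b * s) = b' * p + d' * r -> k * (c * r + d * s) = b' * q + d' * s ->
  semidirect_basis a' b' c' d' (p *: e1 + q *: e2) (r *: e1 + s *: e2) (k *: e3).
Proof.
move=> eB det k0 E1 E2 E3 E4.
have [eB0 _ _ _] := eB.
have H u v : u *: e1 + v *: e2 = comb3 e1 e2 e3 u v 0.
  by rewrite /comb3 scale0r addr0.
have Hk : k *: e3 = comb3 e1 e2 e3 0 0 k by rewrite /comb3 !scale0r !add0r.
rewrite !H Hk; split.
- apply: (basis3_change eB0); apply/comb3P.
  (* The coefficients here and in the next case are the columns of the inverse of [P]. *)
  + exists (s / (p * s - q * r)), (- q / (p * s - q * r)), 0.
    rewrite {1}/comb3 !(comb3Z, comb3D) {1}(comb3_1 e1 e2 e3).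
    by congr comb3; field.
  + exists (- r / (p * s - q * r)), (p / (p * s - q * r)), 0.
    rewrite {1}/comb3 !(comb3Z, comb3D) {1}(comb3_2 e1 e2 e3).
    by congr comb3; field.
  + exists 0, 0, k^-1.
    rewrite {1}/comb3 !(comb3Z, comb3D) {1}(comb3_3 e1 e2 e3).
    by congr comb3; field.
- by rewrite (semidirect_bracket _ _ _ _ _ _ eB) [RHS](comb3_0 e1 e2 e3); congr comb3; ring.
- rewrite (semidirect_bracket _ _ _ _ _ _ eB) !(comb3Z, comb3D).
  by congr comb3; rewrite -?E1 -?E2; ring.
- rewrite (semidirect_bracket _ _ _ _ _ _ eB) !(comb3Z, comb3D).
  by congr comb3; rewrite -?E3 -?E4; ring.
Qed.

(* If U = <x, y> is not abelian, [x, y] = y after rescaling; the Jacobi identity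
   then forces ad z to map U into <y>, and <z - s x, y> is the ideal sought. *)
Lemma semidirect_of_affine_ideal x y z q1 q2 r s :
  basis_of fullv [:: x; y; z] -> [lie x, y] = y ->
  [lie z, x] = q1 *: x + q2 *: y -> [lie z, y] = r *: x + s *: y ->
  semidirect_basis 0 0 (- q2) 1 (z - s *: x) y x.
Proof.
move=> B xy zx zy.
have [c1 [c2 [c3 [_ cE]]]] := coord3 B.
have H u v : u *: x + v *: y = comb3 x y z u v 0.
  by rewrite /comb3 scale0r addr0.
have Hy v : v *: y = comb3 x y z 0 v 0 by rewrite /comb3 !scale0r addr0 add0r.
have [r0 q10] : r = 0 /\ - q1 = 0.
  have J := bracket_jacobi z x y.
  rewrite xy zy (bracketC y z) zy zx -scaleN1r bracketZr !bracketDr !bracketZr in J.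
  rewrite !bracketxx (bracketC y x) xy -(scaleN1r y) in J.
  rewrite !scaler0 add0r addr0 !scalerA H !Hy !comb3D in J.
  have Jc : comb3 x y z r (- q1) 0 = comb3 x y z 0 0 0.
    by rewrite -comb3_0 -J; congr comb3; ring.
  have [Er Eq _] := cE r (- q1) 0; have [E1 E2 _] := cE 0 0 0.
  by rewrite Jc E1 in Er; rewrite Jc E2 in Eq.
rewrite r0 in zy; move/eqP: q10; rewrite oppr_eq0 => /eqP q10.
rewrite q10 !scale0r !add0r in zx zy.
split.
- apply: (basis3_change B); apply/comb3P.
  + by exists 0, 0, 1; rewrite -comb3_3.
  + by exists 0, 1, 0; rewrite -comb3_2.
  + by exists 1, 0, s; rewrite /comb3 scale1r scale0r addr0 subrK.
- by rewrite bracketDl zy -(scaleNr s) bracketZl xy scaleNr subrr.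
- rewrite bracketDr (bracketC x z) zx -(scaleNr s) bracketZr bracketxx.
  by rewrite !scale0r scaler0 addr0 add0r scaleNr.
- by rewrite scale0r add0r scale1r.
Qed.

Lemma semidirect_of_nonabelian_ideal x y z p q p1 q1 p2 q2 :
  basis_of fullv [:: x; y; z] -> q != 0 -> [lie x, y] = p *: x + q *: y ->
  [lie z, x] = p1 *: x + q1 *: y -> [lie z, y] = p2 *: x + q2 *: y ->
  exists a b c d e1 e2 e3, semidirect_basis a b c d e1 e2 e3.
Proof.
move=> B q0 xy zx zy.
have H u v : u *: x + v *: y = comb3 x y z u v 0.
  by rewrite /comb3 scale0r addr0.
have Hx v : v *: x = comb3 x y z v 0 0 by rewrite /comb3 !scale0r !addr0.
(* With [x' = x / q] and [y' = [x, y]] one gets [[x', y'] = y']. The four scalars are the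
   coordinates of [[z, x']] and [[z, y']] in the basis [x'], [y']. *)
do 7!eexists; apply: (@semidirect_of_affine_ideal (q^-1 *: x) (p *: x + q *: y) z
    (p1 - p * q1 / q) (q1 / (q * q)) (q * (p * p1 + q * p2) - p * (p * q1 + q * q2))
    ((p * q1 + q * q2) / q)).
- apply: (basis3_change B); apply/comb3P.
  + exists q, 0, 0; rewrite {1}/comb3 !scale0r !addr0 scalerA divff //.
    by rewrite scale1r.
  + exists (- p), q^-1, 0; rewrite {1}/comb3 scale0r addr0 H Hx !(comb3Z, comb3D).
    by rewrite {1}(comb3_2 x y z); congr comb3; field.
  + by exists 0, 0, 1; apply: comb3_3.
- rewrite bracketZl bracketDr !bracketZr bracketxx scaler0 add0r xy scalerA.
  by rewrite mulVf ?scale1r.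
- rewrite bracketZr zx !H Hx !(comb3Z, comb3D).
  by congr comb3; field.
- rewrite bracketDr !bracketZr zx zy !H Hx !(comb3Z, comb3D).
  by congr comb3; field.
Qed.

Lemma semidirect_of_ideal x y z :
  basis_of fullv [:: x; y; z] ->
  [lie x, y] \in <<[:: x; y]>>%VS -> [lie z, x] \in <<[:: x; y]>>%VS ->
  [lie z, y] \in <<[:: x; y]>>%VS ->
  exists a b c d e1 e2 e3, semidirect_basis a b c d e1 e2 e3.
Proof.
move=> B; have memP u : reflect (exists p q, u = p *: x + q *: y) (u \in <<[:: x; y]>>%VS).
  rewrite span_cons span_seq1; apply: (iffP memv_addP).
    by case=> _ /vlineP[p ->] [_ /vlineP[q ->] ->]; exists p, q.
  by case=> p [q ->]; exists (p *: x); rewrite ?memvZ ?memv_line //;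
     exists (q *: y); rewrite ?memvZ ?memv_line.
case/memP=> al [be xy] /memP[a [c zx]] /memP[b [d zy]].
have [be0|be0] := eqVneq be 0; last exact: semidirect_of_nonabelian_ideal xy zx zy.
have [al0|al0] := eqVneq al 0; last first.
  (* Exchanging [x] and [y] brings the nonzero coefficient into the required position. *)
  apply: (@semidirect_of_nonabelian_ideal y x z (- be) (- al) d b c a).
  - by rewrite (perm_basis _ (_ : perm_eq _ [:: x; y; z])) //= (perm_catCA [:: y] [:: x]).
  - by rewrite oppr_eq0.
  - by rewrite bracketC xy opprD !scaleNr addrC.
  - by rewrite zy addrC.
  - by rewrite zx addrC.
by exists a, b, c, d, x, y, z; split; rewrite // xy al0 be0 !scale0r addr0.
Qed.
End SemidirectBasis.

(** * Isomorphisms and decompositions *)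

Section Isomorphism.
Variable R : fieldType.
Implicit Types g h : lieAlgType R.

Lemma lie_isomorphicP g h (f : g -> h) : linear f -> bijective f ->
  (forall x y, f [lie x, y] = [lie f x, f y]) -> lie_isomorphic g h.
Proof.
move=> fl fB fbr; pose F := GRing.isLinear.Build R g h _ f fl.
by exists (HB.pack_for {linear g -> h} f F).
Qed.

Lemma lie_isomorphic_prod g g' h h' : lie_isomorphic g g' ->
  lie_isomorphic h h' -> lie_isomorphic (g * h)%type (g' * h')%type.
Proof.
move=> [f [[f' fK f'K] fbr]] [k [[k' kK k'K] kbr]].
apply: (@lie_isomorphicP _ _ (fun x => (f x.1, k x.2))) => [a x y||x y].
- by rewrite /= !linearP.
- by exists (fun x => (f' x.1, k' x.2)) => -[x y] /=; rewrite ?fK ?kK ?f'K ?k'K.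
- by congr pair; rewrite /= ?fbr ?kbr.
Qed.

Lemma lie_isomorphic_prodC g h : lie_isomorphic (g * h)%type (h * g)%type.
Proof.
apply: (@lie_isomorphicP _ _ (fun x => (x.2, x.1))) => //.
by exists (fun x => (x.2, x.1)) => -[x y].
Qed.

(** Used when the two summands are recognised in the order opposite to that of the target. *)
Lemma lie_isomorphic_prod_swap g g' h h' : lie_isomorphic g g' ->
  lie_isomorphic h h' -> lie_isomorphic (g * h)%type (h' * g')%type.
Proof.
move=> [f [[f' fK f'K] fbr]] [k [[k' kK k'K] kbr]].
apply: (@lie_isomorphicP _ _ (fun x => (k x.2, f x.1))) => [a x y||x y].
- by rewrite /= !linearP.
- by exists (fun x => (f' x.2, k' x.1)) => -[x y] /=; rewrite ?fK ?kK ?f'K ?k'K.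
- by congr pair; rewrite /= ?fbr ?kbr.
Qed.

Lemma symplectic_isomorphic g h :
  lie_isomorphic g h -> has_symplectic_form h -> has_symplectic_form g.
Proof.
by case=> f [fB fbr] [w ws]; exists (pullback f w); apply: symplectic_pullback.
Qed.

Lemma semidirect_isomorphic g h a b c d (e1 e2 e3 : g) (f1 f2 f3 : h) :
  semidirect_basis a b c d e1 e2 e3 -> semidirect_basis a b c d f1 f2 f3 ->
  lie_isomorphic g h.
Proof.
move=> eB fB; have [eB0 _ _ _] := eB; have [fB0 _ _ _] := fB.
have [c1 [c2 [c3 [gE cE]]]] := coord3 eB0.
have [d1 [d2 [d3 [hE dE]]]] := coord3 fB0.
apply: (@lie_isomorphicP _ _ (fun x => comb3 f1 f2 f3 (c1 x) (c2 x) (c3 x))).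
- by move=> k x y; rewrite !linearP comb3Z comb3D.
- exists (fun x => comb3 e1 e2 e3 (d1 x) (d2 x) (d3 x)) => x.
    by have [-> -> ->] := dE (c1 x) (c2 x) (c3 x).
  by have [-> -> ->] := cE (d1 x) (d2 x) (d3 x).
- move=> x y; rewrite (semidirect_bracket _ _ _ _ _ _ fB).
  rewrite {1 2 3}(gE x) {1 2 3}(gE y) (semidirect_bracket _ _ _ _ _ _ eB).
  by case: (cE (c3 x * (a * c1 y + b * c2 y) - c3 y * (a * c1 x + b * c2 x))
    (c3 x * (c * c1 y + d * c2 y) - c3 y * (c * c1 x + d * c2 x)) 0) => -> -> ->.
Qed.

End Isomorphism.

(** * Solvable algebras of dimension three as semidirect products *)

Section Dim3.
Variables (R : fieldType) (g : lieAlgType R).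
Implicit Types (e x y z : g).

(** Otherwise the derived series would be constant and never reach 0. *)
Lemma solvable_derived_proper : fullv != 0%VS :> {vspace g} -> lie_solvable g ->
  lie_commv fullv fullv != fullv :> {vspace g}.
Proof.
move=> g0 [n gn]; apply: contraNneq g0 => gE; rewrite -gn.
by apply/eqP; elim: n {gn} => //= n <-.
Qed.

Lemma semidirect_of_solvable : \dim {:g} = 3%N -> lie_solvable g ->
  exists a b c d e1 e2 e3, @semidirect_basis R g a b c d e1 e2 e3.
Proof.
move=> dimg solg; set D : {vspace g} := lie_commv fullv fullv.
have /subvPn[z _ zD] : ~~ (fullv <= D)%VS.
  apply/negP => gD.
  have /negP[] : D != fullv.
    by apply: solvable_derived_proper => //; rewrite -dimv_eq0 dimg.
  by rewrite eqEsubv subvf.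
have z0 : z != 0 by apply: contraNneq zD => ->; apply: mem0v.
have DL0 : (D :&: <[z]> = 0)%VS.
  apply/eqP; rewrite -subv0; apply/subvP=> x; rewrite memv_cap => /andP[xD /vlineP[k xk]].
  rewrite memv0; apply: contraNT zD => x0; have k0 : k != 0.
    by apply: contraNneq x0 => k0; rewrite xk k0 scale0r.
  by rewrite -(scalerK k0 z) -xk memvZ.
(* [D + C] is a plane complementary to [z]; containing all brackets, it is an ideal. *)
set C := (D + <[z]>)^C%VS.
have dimD := dimv_disjoint_sum DL0; rewrite dim_vline z0 in dimD.
have DC0 : (D :&: C = 0)%VS.
  apply/eqP; rewrite -subv0 -(capv_compl (D + <[z]>)%VS).
  by rewrite capvS ?addvSl.
have UL : (D + C + <[z]> = fullv)%VS by rewrite -addvA (addvC C) addvA addv_complf.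
have dimU : \dim (D + C)%VS = 2%N.
  have dimDz : (\dim (D + <[z]>)%VS <= 3)%N by rewrite -dimg dimvS ?subvf.
  rewrite (dimv_disjoint_sum DC0) /C dimv_compl dimg dimD.
  by rewrite dimD addn1 in dimDz; rewrite addn1 subSS addnC subnK.
have spanU := span_basis (vbasisP (D + C)%VS).
have: size (vbasis (D + C)%VS) = 2%N by rewrite size_tuple.
move: (tval _) spanU => [|x [|y []]] // spanU _.
have inU u v : [lie u, v] \in <<[:: x; y]>>%VS.
  rewrite spanU; apply: (subvP (addvSl D C)).
  by move/lie_commvP: (subvv D); apply; apply: memvf.
apply: (@semidirect_of_ideal _ _ x y z) => //.
rewrite basisEdim dimg /= andbT -UL -spanU.
by rewrite (_ : [:: x; y; z] = [:: x; y] ++ [:: z]) // span_cat span_seq1.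
Qed.

(** Here [e1] is central, and [e2], [e3] span an ideal because their only bracket is a multiple of
    [e2]. The value [d = 0] covers the abelian algebra. *)
Lemma decomposable_of_kernel d e1 e2 e3 :
  semidirect_basis 0 0 0 d e1 e2 e3 -> ~ lie_indecomposable g.
Proof.
move=> eB; have [eB0 _ _ _] := eB; apply; exists <<[:: e1]>>%VS, <<[:: e2; e3]>>%VS.
have memE x : exists a b c, x = comb3 e1 e2 e3 a b c.
  by apply/comb3P; rewrite (span_basis eB0) memvf.
have := basis_free eB0; rewrite (_ : [:: e1; e2; e3] = [:: e1] ++ [:: e2; e3]) //.
rewrite cat_free => /and3P[F1 F2 Dir]; split => //.
- move=> x y; rewrite span_seq1 => /vlineP[k ->]; have [a [b [c ->]]] := memE x.
  have -> : [lie comb3 e1 e2 e3 a b c, k *: e1] = 0; last exact: mem0v.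
  rewrite [X in k *: X](comb3_1 e1 e2 e3) comb3Z (semidirect_bracket _ _ _ _ _ _ eB).
  by rewrite [RHS](comb3_0 e1 e2 e3); congr comb3; ring.
- move=> x y; rewrite span_cons span_seq1 => /memv_addP[_ /vlineP[k ->] [_ /vlineP[l ->] ->]].
  have [a [b [c ->]]] := memE x.
  have -> : [lie comb3 e1 e2 e3 a b c, k *: e2 + l *: e3] = (d * (c * k - l * b)) *: e2.
    rewrite [X in k *: X](comb3_2 e1 e2 e3) [X in l *: X](comb3_3 e1 e2 e3).
    rewrite [X in _ = _ *: X](comb3_2 e1 e2 e3) !comb3Z comb3D.
    by rewrite (semidirect_bracket _ _ _ _ _ _ eB); congr comb3; ring.
  by apply: (subvP (addvSl _ _)); rewrite memvZ ?memv_line.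
- by rewrite -dimv_eq0 (eqP F1).
- by rewrite -dimv_eq0 (eqP F2).
- by split=> //; rewrite -span_cat (span_basis eB0).
Qed.
End Dim3.

(** * A symplectic form on a product of unimodular algebras *)

Section WedgeTwoForm.
Variables (R : fieldType) (V : vectType R) (w : seq V -> R).
Hypothesis w2 : forall s, size s != 2%N -> w s = 0.
Implicit Types (b : seq V -> R) (s : seq V) (x y z t u v : V).

(** Contracted twice, [w] becomes a scalar. Together with the next two lemmas, where [grade] is
    replaced by its sign in degrees 1 and 2, this expands [wedge w b] on an explicit list as a
    signed sum over pairs of arguments. *)
Lemma wedge_contract2 x y b s :
  wedge (contract y (contract x w)) b s = w [:: x; y] * b s.
Proof.
elim: s b => [|z s IHs] b //=.
rewrite wedge_eq0 ?add0r; last by move=> t u _; left; rewrite /contract w2.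
rewrite (@eq_wedge _ _ _ (contract y (contract x w)) _ (contract z b)) ?IHs // => t.
rewrite /grade; case: t => [|t0 t]; first by rewrite mul1r.
by rewrite /contract w2 ?mulr0.
Qed.

Lemma wedge_contract1 x b y s :
  wedge (contract x w) b (y :: s) =
  w [:: x; y] * b s - wedge (contract x w) (contract y b) s.
Proof.
rewrite /= wedge_contract2 -wedgeNl; congr (_ + _); apply: eq_wedge => // t.
rewrite /grade /contract; case: (eqVneq (size t) 1%N) => [->|t1].
  by rewrite expr1 mulN1r.
by rewrite w2 ?mulr0 ?oppr0.
Qed.

Lemma wedge_2form_cons b x s :
  wedge w b (x :: s) = wedge (contract x w) b s + wedge w (contract x b) s.
Proof.
rewrite /=; congr (_ + _); apply: eq_wedge => // t; rewrite /grade.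
case: (eqVneq (size t) 2%N) => [->|t2]; first by rewrite sqrrN expr1n mul1r.
by rewrite w2 ?mulr0.
Qed.

Lemma wedge_2form_nil b : wedge w b [::] = 0.
Proof. by rewrite /= w2 ?mul0r. Qed.

Lemma wedge_contract1_nil x b : wedge (contract x w) b [::] = 0.
Proof. by rewrite /= /contract w2 ?mul0r. Qed.

Definition wedge_2formE :=
  (wedge_2form_cons, wedge_2form_nil, wedge_contract1, wedge_contract1_nil).

Lemma wedge_2form4 b x1 x2 x3 x4 :
  wedge w b [:: x1; x2; x3; x4] =
    w [:: x1; x2] * b [:: x3; x4] - w [:: x1; x3] * b [:: x2; x4]
  + w [:: x1; x4] * b [:: x2; x3] + w [:: x2; x3] * b [:: x1; x4]
  - w [:: x2; x4] * b [:: x1; x3] + w [:: x3; x4] * b [:: x1; x2].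
Proof. by rewrite !wedge_2formE /contract; ring. Qed.

Lemma wedge_2form6 b x1 x2 x3 x4 x5 x6 :
  wedge w b [:: x1; x2; x3; x4; x5; x6] =
    w [:: x1; x2] * b [:: x3; x4; x5; x6] - w [:: x1; x3] * b [:: x2; x4; x5; x6]
  + w [:: x1; x4] * b [:: x2; x3; x5; x6] - w [:: x1; x5] * b [:: x2; x3; x4; x6]
  + w [:: x1; x6] * b [:: x2; x3; x4; x5] + w [:: x2; x3] * b [:: x1; x4; x5; x6]
  - w [:: x2; x4] * b [:: x1; x3; x5; x6] + w [:: x2; x5] * b [:: x1; x3; x4; x6]
  - w [:: x2; x6] * b [:: x1; x3; x4; x5] + w [:: x3; x4] * b [:: x1; x2; x5; x6]
  - w [:: x3; x5] * b [:: x1; x2; x4; x6] + w [:: x3; x6] * b [:: x1; x2; x4; x5]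
  + w [:: x4; x5] * b [:: x1; x2; x3; x6] - w [:: x4; x6] * b [:: x1; x2; x3; x5]
  + w [:: x5; x6] * b [:: x1; x2; x3; x4].
Proof. by rewrite !wedge_2formE /contract; ring. Qed.

Lemma wedge_exp1 s : wedge_exp w 1 s = w s.
Proof.
rewrite -[LHS]/(wedge w (fun t : seq V => (nilp t)%:R) s).
have [/eqP|s2] := eqVneq (size s) 2%N; last first.
  rewrite w2 // wedge_eq0 // => t u tu.
  case: (eqVneq (size t) 2%N) => [t2|/w2->]; last by left.
  right; case: u tu => [|? ?] //= tu; by rewrite -tu t2 in s2.
case: s => [|x [|y []]] // _.
by rewrite !wedge_2formE /contract /=; ring.
Qed.

End WedgeTwoForm.

Section ProductSymplectic.
Variables (R : numFieldType) (g h : lieAlgType R).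

(** The differential of the area form on each plane is proportional to the trace, hence zero, while
    [c3] and [d3] kill all brackets, so their wedge product is closed. *)
Lemma product_symplectic a b c (e1 e2 e3 : g) a' b' c' (f1 f2 f3 : h) :
  semidirect_basis a b c (- a) e1 e2 e3 ->
  semidirect_basis a' b' c' (- a') f1 f2 f3 ->
  has_symplectic_form (g * h)%type.
Proof.
move=> eB fB; have [eB0 _ _ _] := eB; have [fB0 _ _ _] := fB.
have [c1 [c2 [c3 [gE cE]]]] := coord3 eB0.
have [d1 [d2 [d3 [hE dE]]]] := coord3 fB0.
pose beta (x y : g * h) : R :=
  c1 x.1 * c2 y.1 - c1 y.1 * c2 x.1 + (d1 x.2 * d2 y.2 - d1 y.2 * d2 x.2)
  + (c3 x.1 * d3 y.2 - c3 y.1 * d3 x.2).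
pose w (s : seq (g * h)) : R := if s is [:: x; y] then beta x y else 0.
have w2 s : size s != 2%N -> w s = 0 by case: s => [|? [|? [|? ?]]].
exists w; exists 3%N.
  rewrite dimvf -[LHS]/(dim g + dim h)%N -!dimvf.
  by rewrite (size_basis eB0) (size_basis fB0).
split.
- split=> // [s t k x y|s t u x].
    rewrite /w; case: s => [|s0 [|s1 s]] /=.
    + case: t => [|t0 [|t1 t]] /=; rewrite ?mulr0 ?addr0 //.
      by rewrite /beta /= !linearP; ring.
    + case: t => [|t0 t] /=; rewrite ?mulr0 ?addr0 //.
      by rewrite /beta /= !linearP; ring.
    + by case: s => [|? ?] /=; rewrite ?mulr0 ?addr0.
  case: s => [|s0 s]; last by apply: w2; rewrite /= size_cat /= size_cat /= !addnS.
  case: t => [|t0 t]; last by apply: w2; rewrite /= size_cat /= !addnS.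
  by case: u => [|? ?] //=; rewrite /beta; ring.
- move=> s; have [/eqP s3|s3] := eqVneq (size s) 3%N; last first.
    by rewrite ext_diff_eq0 // => t ts; rewrite w2 //; apply: contraNneq s3 => t2; rewrite -ts t2.
  case: s s3 => [|x [|y [|z []]]] // _; rewrite ext_diff_2form /w /beta /=.
  have gb u v : [/\ c1 [lie u, v] = c3 u * (a * c1 v + b * c2 v) - c3 v * (a * c1 u + b * c2 u),
      c2 [lie u, v] = c3 u * (c * c1 v + - a * c2 v) - c3 v * (c * c1 u + - a * c2 u) &
      c3 [lie u, v] = 0].
    have := semidirect_bracket (c1 u) (c2 u) (c3 u) (c1 v) (c2 v) (c3 v) eB.
    by rewrite -gE -gE => ->; apply: cE.
  have hb u v : [/\ d1 [lie u, v] = d3 u * (a' * d1 v + b' * d2 v) - d3 v * (a' * d1 u + b' * d2 u),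
      d2 [lie u, v] = d3 u * (c' * d1 v + - a' * d2 v) - d3 v * (c' * d1 u + - a' * d2 u) &
      d3 [lie u, v] = 0].
    have := semidirect_bracket (d1 u) (d2 u) (d3 u) (d1 v) (d2 v) (d3 v) fB.
    by rewrite -hE -hE => ->; apply: dE.
  case: x y z => x x' [y y'] [z z'] /=.
  have [-> -> ->] := gb x y; have [-> -> ->] := gb x z; have [-> -> ->] := gb y z.
  have [-> -> ->] := hb x' y'; have [-> -> ->] := hb x' z'; have [-> -> ->] := hb y' z'.
  by ring.
(* The order puts each pair dual to a summand of [w] side by side, so the cube of [w] takes the
   value [3! = 6] on [E], nonzero in characteristic 0. *)
- pose E : seq (g * h) := [:: (e1, 0); (e2, 0); (0, f1); (0, f2); (e3, 0); (0, f3)].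
  move=> /(_ E); rewrite -[wedge_exp w 3 E]/(wedge w (wedge_exp w 2) E) /E.
  rewrite (wedge_2form6 w2).
  have W4 x1 x2 x3 x4 : wedge_exp w 2 [:: x1; x2; x3; x4] =
    2 * (w [:: x1; x2] * w [:: x3; x4] - w [:: x1; x3] * w [:: x2; x4]
        + w [:: x1; x4] * w [:: x2; x3]).
    rewrite -[LHS]/(wedge w (wedge_exp w 1) _) (wedge_2form4 w2) !(wedge_exp1 w2).
    by ring.
  rewrite !W4 /w /beta /= !linear0.
  have [E11 E12 E13] := cE 1 0 0; rewrite -!comb3_1 in E11 E12 E13.
  have [E21 E22 E23] := cE 0 1 0; rewrite -!comb3_2 in E21 E22 E23.
  have [E31 E32 E33] := cE 0 0 1; rewrite -!comb3_3 in E31 E32 E33.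
  have [F11 F12 F13] := dE 1 0 0; rewrite -!comb3_1 in F11 F12 F13.
  have [F21 F22 F23] := dE 0 1 0; rewrite -!comb3_2 in F21 F22 F23.
  have [F31 F32 F33] := dE 0 0 1; rewrite -!comb3_3 in F31 F32 F33.
  rewrite !(E11, E12, E13, E21, E22, E23, E31, E32, E33).
  rewrite !(F11, F12, F13, F21, F22, F23, F31, F32, F33).
  rewrite !(mul0r, mulr0, mulr1, subr0, addr0, add0r, oppr0).
  by rewrite !mul1r -!natrD => /eqP; rewrite pnatr_eq0.
Qed.
End ProductSymplectic.

(** * The obstruction and the nilpotent case *)

Section Obstruction.
Variables (R : fieldType) (g h : lieAlgType R).

Lemma symplectic_unimodular a b c d (e1 e2 e3 : g) :
  semidirect_basis a b c d e1 e2 e3 -> a * d - b * c != 0 ->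
  has_symplectic_form (g * h)%type -> a + d = 0.
Proof.
move=> eB det [w ws]; have [n _ [wf _ _]] := ws; have [eB0 e12 e31 e32] := eB.
have [wl wa] := is_form_adj wf.
have [c1 [c2 [c3 [gE cE]]]] := coord3 eB0.
have dec x y : (x, y) = (x, 0) + (0, y) :> g * h.
  by congr pair; rewrite /= ?addr0 ?add0r.
have inlD x y : (x + y, 0) = (x, 0) + (y, 0) :> g * h by congr pair; rewrite /= addr0.
have inlZ k x : (k *: x, 0) = k *: (x, 0) :> g * h by congr pair; rewrite /= scaler0.
pose L (x : g) (y : g * h) := w [:: (x, 0); y].
have LD x x' y : L (x + x') y = L x y + L x' y.
  by rewrite /L inlD; apply: (multilinearD [::] [:: y]).
have LZ k x y : L (k *: x) y = k * L x y.
  by rewrite /L inlZ; apply: (multilinearZ [::] [:: y]).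
have LDr x y y' : L x (y + y') = L x y + L x y'.
  exact: (multilinearD [:: (x, 0)] [::] y y').
have L0r x : L x 0 = 0 by exact: (multilinear0 [:: (x, 0)] [::]).
have LZr k x y : L x (k *: y) = k * L x y.
  exact: (multilinearZ [:: (x, 0)] [::] k y).
have LC x y : L x (y, 0) = - L y (x, 0) by exact: (adj_swap [::] [::] (x, 0) (y, 0)).
have Lxx x : L x (x, 0) = 0 by exact: (wa [::] [::] (x, 0)).
have brl x y : [lie (x, 0) : g * h, (y, 0)] = ([lie x, y], 0).
  by congr pair; apply: bracket0l.
have br0 x u : [lie (x, 0) : g * h, (0, u)] = 0.
  by congr pair; rewrite /= ?bracket0l ?bracket0r.
(* Closedness on [e3], [x], [u], where both mixed brackets vanish. *)
have Lh x u : L [lie e3, x] (0, u) = 0.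
  have := symplectic_closed (e3, 0) (x, 0) (0, u) ws.
  by rewrite brl !br0 -/(L _ _) -!/(L _ 0) !L0r addr0.
(* The action of [e3] is invertible on the ideal; the linear system is solved by Cramer's rule. *)
have Lh12 u : L e1 (0, u) = 0 /\ L e2 (0, u) = 0.
  have := Lh e1 u; have := Lh e2 u; rewrite e31 e32 !LD !LZ => E2 E1.
  split; apply: (mulfI det); rewrite mulr0.
    by transitivity (d * (a * L e1 (0, u) + c * L e2 (0, u)) -
      c * (b * L e1 (0, u) + d * L e2 (0, u))); [ring | rewrite E1 E2; ring].
  by transitivity (a * (b * L e1 (0, u) + d * L e2 (0, u)) -
      b * (a * L e1 (0, u) + c * L e2 (0, u))); [ring | rewrite E1 E2; ring].
have L12 : (a + d) * L e1 (e2, 0) = 0.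
  have := symplectic_closed (e3, 0) (e1, 0) (e2, 0) ws.
  rewrite !brl e12 -!/(L _ _) L0r e31 e32 inlD !inlZ LD !LZ LDr !LZr !Lxx => <-.
  by ring.
apply/eqP; apply/negP => /negP t0.
have {}L12 : L e1 (e2, 0) = 0 by apply: (mulfI t0); rewrite mulr0.
(* The ideal is now orthogonal to itself and to [h], so a vector of it that is orthogonal to [e3]
   too lies in the radical. *)
have K k l : k * L e1 (e3, 0) + l * L e2 (e3, 0) = 0 -> k = 0 /\ l = 0.
  move=> kl; have H : k *: e1 + l *: e2 = comb3 e1 e2 e3 k l 0.
    by rewrite /comb3 scale0r addr0.
  have [E1 E2 _] := cE k l 0; rewrite -H in E1 E2.
  suff /(congr1 fst) /= V0 : (k *: e1 + l *: e2, 0) = 0 :> g * h.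
    by split; [rewrite -[LHS]E1 | rewrite -[LHS]E2]; rewrite V0 linear0.
  apply: (symplectic_nondegenerate ws) => -[x u].
  rewrite -/(L _ _) dec LDr !LD !LZ; have [-> ->] := Lh12 u.
  rewrite (gE x) /comb3 !inlD !inlZ !LDr !LZr !Lxx L12 (LC e2 e1) L12.
  transitivity (c3 x * (k * L e1 (e3, 0) + l * L e2 (e3, 0))); first by ring.
  by rewrite kl mulr0.
(* This combination is orthogonal to [e3] by construction, so both pairings with [e3] vanish. Then
   [e1] itself lies in the radical, a contradiction. *)
have [|l20 /eqP] := K (L e2 (e3, 0)) (- L e1 (e3, 0)); first by ring.
rewrite oppr_eq0 => /eqP l10; have [|/eqP] := K 1 0; first by rewrite l10 mulr0 mul0r addr0.
by rewrite oner_eq0.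
Qed.
End Obstruction.

Section Nilpotent.
Variables (R : fieldType) (g h : lieAlgType R).
(** All brackets lie in the span [Z] of the central vectors [(e2, 0)] and [(0, f2)]. *)
Lemma heisenberg_prod_nilpotent (e1 e2 e3 : g) (f1 f2 f3 : h) :
  semidirect_basis 0 0 1 0 e1 e2 e3 -> semidirect_basis 0 0 1 0 f1 f2 f3 ->
  lie_nilpotent (g * h)%type.
Proof.
move=> eB fB; have [eB0 _ _ _] := eB; have [fB0 _ _ _] := fB.
have [c1 [c2 [c3 [gE _]]]] := coord3 eB0.
have [d1 [d2 [d3 [hE _]]]] := coord3 fB0.
pose u : (g * h)%type := (e2, 0); pose v : (g * h)%type := (0, f2).
pose Z := (<[u]> + <[v]>)%VS.
have ZP k l : (k *: e2, l *: f2) \in Z.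
  rewrite (_ : (_, _) = k *: u + l *: v).
    by rewrite memv_add ?memvZ ?memv_line.
  by congr pair; rewrite /= ?scaler0 ?addr0 ?add0r.
have DZ : (lie_commv fullv fullv <= Z)%VS.
  apply/lie_commvP => -[x x'] [y y'] _ _.
  suff [k [l]] : exists k l, [lie (x, x') : g * h, (y, y')] = (k *: e2, l *: f2).
    by move->.
  exists (c3 x * c1 y - c3 y * c1 x), (d3 x' * d1 y' - d3 y' * d1 x'); congr pair => /=.
    have := semidirect_bracket (c1 x) (c2 x) (c3 x) (c1 y) (c2 y) (c3 y) eB.
    rewrite -gE -gE => ->; rewrite [X in _ = _ *: X](comb3_2 e1 e2 e3) comb3Z.
    by congr comb3; ring.
  have := semidirect_bracket (d1 x') (d2 x') (d3 x') (d1 y') (d2 y') (d3 y') fB.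
  rewrite -hE -hE => ->; rewrite [X in _ = _ *: X](comb3_2 f1 f2 f3) comb3Z.
  by congr comb3; ring.
(* The iteration starts at the whole algebra, so its second term consists of double brackets. *)
exists 2%N => /=; apply/eqP; rewrite -subv0; apply/lie_commvP => -[x x'] y _.
move/(subvP DZ)/memv_addP => [_ /vlineP[k ->] [_ /vlineP[l ->] ->]].
rewrite memv0; apply/eqP; congr pair => /=.
  rewrite scaler0 addr0 [X in k *: X](comb3_2 e1 e2 e3) comb3Z (gE x).
  by rewrite (semidirect_bracket _ _ _ _ _ _ eB) [RHS](comb3_0 e1 e2 e3); congr comb3; ring.
rewrite scaler0 add0r [X in l *: X](comb3_2 f1 f2 f3) comb3Z (hE x').
by rewrite (semidirect_bracket _ _ _ _ _ _ fB) [RHS](comb3_0 f1 f2 f3); congr comb3; ring.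
Qed.
End Nilpotent.

(** * Classification *)

Section Classification.
Variables (R : numFieldType) (g : lieAlgType R).
Implicit Types e f : g.

(** A singular matrix with nonzero trace is diagonalizable with eigenvalues 0 and [a + d], and then
    [g] splits. Since [a] and [d] are not both 0, exchanging [e1] and [e2] allows [a != 0]. *)
Lemma indecomposable_det a b c d e1 e2 e3 : lie_indecomposable g ->
  semidirect_basis a b c d e1 e2 e3 -> a + d != 0 -> a * d - b * c != 0.
Proof.
move=> gI; wlog a0 : a b c d e1 e2 / a != 0 => [IH eB t0|].
  have [a0|] := eqVneq a 0; last by move=> a0; apply: IH eB t0.
  rewrite mulrC [b * c]mulrC; apply: (IH d c b a (0 *: e1 + 1 *: e2) (1 *: e1 + 0 *: e2)).
  - by move: t0; rewrite a0 add0r.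
  - rewrite -[e3]scale1r; apply: (semidirect_change eB); rewrite ?oner_neq0 //; try by ring.
    by rewrite mul0r sub0r mulr1 oppr_eq0 oner_neq0.
  - by rewrite addrC.
move=> eB t0; apply/eqP => det0; apply: decomposable_of_kernel gI.
have bc : b * c = a * d by apply/esym/eqP; rewrite -subr_eq0 det0.
(* [(b, - a)] spans the kernel, and [(a, c)], the first column, is an eigenvector for [a + d]. Their
   determinant is [a * (a + d)]. *)
apply: (semidirect_change (p := b) (q := - a) (r := a) (s := c) (k := 1)
          (d' := a + d) eB); rewrite ?oner_neq0 //.
- by rewrite bc mulNr opprK -mulrDr mulf_neq0 // addrC.
- by ring.
- by rewrite mulrN (mulrC c) bc; ring.
- by rewrite bc; ring.
- by ring.
Qed.

(** By Cayley-Hamilton the square of the traceless matrix is the scalar [a ^+ 2 + b * c], so a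
    cyclic vector and its image give the companion form. *)
Lemma traceless_companion a b c e1 e2 e3 : lie_indecomposable g ->
  semidirect_basis a b c (- a) e1 e2 e3 ->
  exists mu f1 f2 f3, semidirect_basis 0 mu 1 0 f1 f2 f3.
Proof.
move=> gI eB.
(* For q(p, r) = c p^2 - 2 a p r - b r^2, the vector u = p e1 + r e2 is cyclic for
   the action of e3 as soon as q(p, r) != 0. *)
have cyc p r : c * p ^+ 2 - 2 * a * p * r - b * r ^+ 2 != 0 ->
    exists mu f1 f2 f3, semidirect_basis 0 mu 1 0 f1 f2 f3.
  move=> q0; exists (a ^+ 2 + b * c).
  exists (p *: e1 + r *: e2), ((a * p + b * r) *: e1 + (c * p - a * r) *: e2), (1 *: e3).
  apply: (semidirect_change eB); rewrite ?oner_neq0 //; try by ring.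
  by move: q0; congr (_ != 0); ring.
(* The vectors [e1], [e2] and [e1 + e2] are tried in turn; if none is cyclic, the matrix is 0 and
   [g] is abelian, hence decomposable. *)
have [c0|c0] := eqVneq c 0; last by apply: (cyc 1 0); move: c0; congr (_ != 0); ring.
have [b0|b0] := eqVneq b 0; last first.
  by apply: (cyc 0 1); rewrite -oppr_eq0; move: b0; congr (_ != 0); ring.
have [a0|a0] := eqVneq a 0.
  case: (decomposable_of_kernel (d := 0) (e1 := e1) (e2 := e2) (e3 := e3)) => //.
  by move: eB; rewrite a0 b0 c0 oppr0.
apply: (cyc 1 1); rewrite b0 c0.
have -> : 0 * 1 ^+ 2 - 2 * a * 1 * 1 - 0 * 1 ^+ 2 = - (2 * a) by ring.
by rewrite oppr_eq0 mulf_neq0 // pnatr_eq0.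
Qed.

Lemma solvable3_cases : \dim {:g} = 3%N -> lie_solvable g -> lie_indecomposable g ->
  (exists a b c d e1 e2 e3, [/\ @semidirect_basis R g a b c d e1 e2 e3,
     a + d != 0 & a * d - b * c != 0]) \/
  (exists mu e1 e2 e3, @semidirect_basis R g 0 mu 1 0 e1 e2 e3).
Proof.
move=> dimg gS gI; have [a [b [c [d [e1 [e2 [e3 eB]]]]]]] := semidirect_of_solvable dimg gS.
have [t0|t0] := eqVneq (a + d) 0; [right | left]; last first.
  by exists a, b, c, d, e1, e2, e3; split=> //; apply: indecomposable_det eB t0.
apply: (traceless_companion (a := a) (b := b) (c := c) (e1 := e1) (e2 := e2) (e3 := e3)) => //.
by rewrite (_ : - a = d) //; apply/eqP; rewrite eq_sym -addr_eq0 addrC t0.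
Qed.

End Classification.

(** * Matrices of the three model algebras *)

Section Models.
Local Arguments wedge : simpl never.
Variable R : fieldType.

Lemma delta_basis3 : basis_of fullv
  [:: delta_mx 0 0 : 'rV[R]_3; delta_mx 0 1; delta_mx 0 2].
Proof.
rewrite basisEdim dimvf /= andbT; apply/subvP => x _; apply/comb3P.
exists (x 0 0), (x 0 1), (x 0 2); apply/rowP => -[[|[|[|//]]] ?];
by rewrite !mxE !(inordK, eqE) /= ?mulr1 ?mulr0 ?addr0 ?add0r; congr (x 0 _); apply: val_inj.
Qed.

(** Since [d omega(X, Y) = - omega([X, Y])], a term [omega_j /\ omega_3] in [d omega_i] contributes
    [+ e_i] to [[e3, e_j]]; the matrices are thus read off the Maurer-Cartan equations without a
    sign change. *)
Lemma A31_basis :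
  @semidirect_basis R (A31 R) 0 1 0 0 (delta_mx 0 0) (delta_mx 0 1) (delta_mx 0 2).
Proof.
split; first exact: delta_basis3.
all: apply/rowP=> -[[|[|[|//]]] ?];
by rewrite !mxE /A31_mc /forms3 /= ?wedge_dual3 ?mxE /=; ring.
Qed.

Lemma A34m1_basis :
  @semidirect_basis R (A34m1 R) 1 0 0 (-1) (delta_mx 0 0) (delta_mx 0 1) (delta_mx 0 2).
Proof.
split; first exact: delta_basis3.
all: apply/rowP=> -[[|[|[|//]]] ?];
by rewrite !mxE /A34_mc /forms3 /= ?wedge_dual3 ?mxE /=; ring.
Qed.

Lemma A35_0_basis :
  @semidirect_basis R (A35_0 R) 0 1 (-1) 0 (delta_mx 0 0) (delta_mx 0 1) (delta_mx 0 2).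
Proof.
split; first exact: delta_basis3.
all: apply/rowP=> -[[|[|[|//]]] ?];
by rewrite !mxE /A35_mc /forms3 /= ?wedge_dual3 ?mxE /=; ring.
Qed.
End Models.

(** * Real normal forms of the traceless case *)

Section RealClassification.
Variables (R : rcfType) (g : lieAlgType R).
Implicit Types e : g.

Lemma companion_A31 e1 e2 e3 :
  semidirect_basis 0 0 1 0 e1 e2 e3 -> lie_isomorphic g (A31 R).
Proof.
move=> eB; apply: semidirect_isomorphic (A31_basis R).
apply: (semidirect_change (p := 0) (q := 1) (r := 1) (s := 0) (k := 1) eB);
  rewrite ?oner_neq0 //; try by ring.
by rewrite mul0r sub0r mulr1 oppr_eq0 oner_neq0.
Qed.

Lemma companion_A34m1 (mu : R) e1 e2 e3 : 0 < mu ->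
  semidirect_basis 0 mu 1 0 e1 e2 e3 -> lie_isomorphic g (A34m1 R).
Proof.
move=> mu0 eB.
have l0 : Num.sqrt mu != 0 by rewrite gt_eqF ?sqrtr_gt0.
have := sqr_sqrtr (ltW mu0); move: (Num.sqrt mu) l0 => l l0 lmu.
rewrite -lmu in eB; apply: semidirect_isomorphic (A34m1_basis R).
(* [(l, 1)] and [(l, -1)] are eigenvectors for [l] and [- l]; the factor [l^-1] normalises the
   eigenvalues to 1 and -1. *)
apply: (semidirect_change (p := l) (q := 1) (r := l) (s := -1) (k := l^-1) eB);
  rewrite ?invr_eq0 //; try by field.
have -> : l * -1 - 1 * l = - (2 * l) by ring.
by rewrite oppr_eq0 mulf_neq0 // pnatr_eq0.
Qed.

Lemma companion_A35_0 (mu : R) e1 e2 e3 : mu < 0 ->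
  semidirect_basis 0 mu 1 0 e1 e2 e3 -> lie_isomorphic g (A35_0 R).
Proof.
rewrite -oppr_gt0 => mu0 eB.
have l0 : Num.sqrt (- mu) != 0 by rewrite gt_eqF ?sqrtr_gt0.
have := sqr_sqrtr (ltW mu0); move: (Num.sqrt (- mu)) l0 => l l0 lmu.
rewrite -[mu]opprK -lmu in eB; apply: semidirect_isomorphic (A35_0_basis R).
(* In the basis [e2], [l *: e1] the action is [l] times a quarter turn. *)
apply: (semidirect_change (p := 0) (q := 1) (r := l) (s := 0) (k := l^-1) eB);
  rewrite ?invr_eq0 //; try by field.
by rewrite mul0r sub0r mul1r oppr_eq0.
Qed.

Lemma companion_cases (mu : R) e1 e2 e3 : semidirect_basis 0 mu 1 0 e1 e2 e3 ->
  mu = 0 \/ lie_isomorphic g (A34m1 R) \/ lie_isomorphic g (A35_0 R).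
Proof.
move=> eB; have [mu0|mu0|->] := ltgtP mu 0; [right; right | right; left | by left].
  exact: companion_A35_0 mu0 eB.
exact: companion_A34m1 mu0 eB.
Qed.

End RealClassification.

Theorem mainTheorem2 (R : realType) (r1 r2 : lieAlgType R)
    (dim_r1 : \dim {:r1} = 3%N) (dim_r2 : \dim {:r2} = 3%N)
    (solvable_r1 : lie_solvable r1) (solvable_r2 : lie_solvable r2)
    (indecomposable_r1 : lie_indecomposable r1)
    (indecomposable_r2 : lie_indecomposable r2)
    (not_nilpotent : ~ lie_nilpotent (r1 * r2)%type) :
  has_symplectic_form (r1 * r2)%type <->
    lie_isomorphic (r1 * r2)%type (A31 R * A34m1 R)%type \/
    lie_isomorphic (r1 * r2)%type (A31 R * A35_0 R)%type \/
    lie_isomorphic (r1 * r2)%type (A34m1 R * A34m1 R)%type \/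
    lie_isomorphic (r1 * r2)%type (A34m1 R * A35_0 R)%type \/
    lie_isomorphic (r1 * r2)%type (A35_0 R * A35_0 R)%type.
Proof.
have B31 := A31_basis R; have B34 := A34m1_basis R; have B35 := A35_0_basis R.
(* The last matrix entry 0 is written as [- 0] to match the traceless shape required by
   [product_symplectic]. *)
rewrite -{3}(oppr0 R) in B31; rewrite -{2}(oppr0 R) in B35.
split=> [rS|].
  have [[a [b [c [d [e1 [e2 [e3 [eB t0 det]]]]]]]]|] :=
      solvable3_cases dim_r1 solvable_r1 indecomposable_r1.
    by rewrite (symplectic_unimodular eB det rS) eqxx in t0.
  move=> [mu [e1 [e2 [e3 eB]]]].
  have [[a [b [c [d [f1 [f2 [f3 [fB t0 det]]]]]]]]|] :=
      solvable3_cases dim_r2 solvable_r2 indecomposable_r2.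
    have rS' := symplectic_isomorphic (lie_isomorphic_prodC r2 r1) rS.
    by rewrite (symplectic_unimodular fB det rS') eqxx in t0.
  move=> [nu [f1 [f2 [f3 fB]]]].
  have [mu0|r1E] := companion_cases eB; have [nu0|r2E] := companion_cases fB.
  (* Two Heisenberg summands: the one combination excluded by non-nilpotency. *)
  - rewrite mu0 in eB; rewrite nu0 in fB.
    by case: not_nilpotent; apply: heisenberg_prod_nilpotent eB fB.
  - rewrite mu0 in eB; have r1E := companion_A31 eB.
    by case: r2E => r2E; have H := lie_isomorphic_prod r1E r2E; tauto.
  - rewrite nu0 in fB; have r2E := companion_A31 fB.
    by case: r1E => r1E; have H := lie_isomorphic_prod_swap r1E r2E; tauto.
  - case: r1E => r1E; case: r2E => r2E; have H := lie_isomorphic_prod r1E r2E;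
      have H' := lie_isomorphic_prod_swap r1E r2E; tauto.
have S := @product_symplectic R.
case=> [|[|[|[|]]]] /symplectic_isomorphic; apply.
- exact: S B31 B34.
- exact: S B31 B35.
- exact: S (B34) (B34).
- exact: S B34 B35.
- exact: S (B35) (B35).
Qed.
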